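(* Let $\omega_3=e^{2\pi i/3}$, $\theta_3=\arcsin(1/\sqrt3)$, $z_3=\tan\frac{\theta_3}{2}\,e^{-5\pi i/6}$ and $\xi=(1+z_3+1/z_3)/\sqrt3$. The matrix $$U_4^{q}=\frac{1}{\sqrt6}\begin{pmatrix}\sqrt3&1&1&1\\0&\xi&\xi\omega_3&\xi\omega_3^2\\0&\xi&\xi\omega_3^2&\xi\omega_3\\-\sqrt3&1&1&1\end{pmatrix}$$ is unitary, so that its columns represent an orthonormal basis of $\mathcal H_4$ (spin $j=3/2$), and this basis is a most quantum basis of $\mathcal H_4$, with $\mathcal B_1(U_4^{q})=1$. That is, $\mathcal B_1(U)\le\mathcal B_1(U_4^{q})=1$ for every $U\in U(4)$.
   Context: For $j\in\{\tfrac12,1,\tfrac32,\dots\}$ let $N=2j+1$ and let $\mathcal H_{N}=\mathbb C^{N}$ be the spin-$j$ Hilbert space with orthonormal basis $\ket{j,m}$, $m=j,j-1,\dots,-j$, of eigenvectors of the angular momentum operator $J_z$. For $0\le k\le 2j$ let $\ket{D_{2j,k}}\in(\mathbb C^2)^{\otimes 2j}$ be the Dicke state: $\binom{2j}{k}^{-1/2}$ times the sum of the $\binom{2j}{k}$ distinct computational basis vectors having exactly $k$ tensor factors $\ket1$ and $2j-k$ tensor factors $\ket0$. Let $F:\mathcal H_{2j+1}\to(\mathbb C^2)^{\otimes 2j}$ be the linear isometry onto the symmetric subspace with $F\ket{j,m}=\ket{D_{2j,j-m}}$. For a unit vector $\ket\psi\in\mathcal H_{2j+1}$ and an integer $1\le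 t\le 2j$, let $\rho_t$ be the reduced density operator on $t$ qubits obtained from the projector onto $F\ket\psi$ by tracing out $2j-t$ qubits (by symmetry, which ones is irrelevant), and let $R_t(F(\ket\psi))=\mathrm{tr}(\rho_t^2)$. The measure of anticoherence of order $t$ is $$\mathcal A_t(\ket\psi)=\frac{t+1}{t}\bigl[1-R_t(F(\ket\psi))\bigr].$$ A unitary $U\in U(N)$ represents the orthonormal basis $\ket{\psi_1},\dots,\ket{\psi_N}$ of $\mathcal H_N$ whose $i$-th vector is the $i$-th column of $U$, i.e. $U_{ki}=\langle j,m|\psi_i\rangle$ with $m=j+1-k$. The quantumness of the basis is $$\mathcal B_t(U)=\frac1N\sum_{i=1}^N\mathcal A_t(\ket{\psi_i}).$$ A most quantum basis is one maximizing $\mathcal B_1$ over all $U\in U(N)$. *)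

(* Defs.v *)
From HB Require Import structures.
From mathcomp Require Import all_boot all_order all_algebra.
From mathcomp Require Import complex.
From mathcomp Require Import reals trigo.

Set Implicit Arguments.
Unset Strict Implicit.
Unset Printing Implicit Defensive.

Import Order.TTheory GRing.Theory Num.Theory.

Local Open Scope ring_scope.
Local Open Scope complex_scope.
Local Open Scope sesquilinear_scope.

(* Throughout, n stands for 2j >= 1, so the spin-j space is 'cV[R[i]]_n.+1, and
   the coordinate of index k (0 <= k <= n) is the one along |j, j - k>.        *)

(* Index type of the computational basis of n qubits; true stands for |1>.     *)
Definition bits (n : nat) : finType := n.-tuple bool.

Section Qubits.
Variable R : realType.
Local Notation C := R[i].

Definition comp_ket (n : nat) (b : bits n) : 'cV[C]_#|bits n| :=
  delta_mx (enum_rank b) 0.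

Definition dicke (n k : nat) : 'cV[C]_#|bits n| :=
  (Num.sqrt ('C(n, k)%:R : R))%:C^-1 *:
    \sum_(b : bits n | count_mem true b == k) comp_ket b.

(* Matrix of F : |j, j - k> |-> |D_{2j, k}>.                                   *)
Definition sym_embedding (n : nat) : 'M[C]_(#|bits n|, n.+1) :=
  \matrix_(x < #|bits n|, k < n.+1) dicke n k x 0.

Definition projector (d : nat) (v : 'cV[C]_d) : 'M[C]_d := v *m v ^t*.

(* For t <= n this is the concatenation a ++ c, seen as an n-tuple.            *)
Definition join_bits (n t : nat) (a : bits t) (c : bits (n - t)) : bits n :=
  [tuple nth false (a ++ c) i | i < n].

(* Partial trace over the last n - t qubits, for t <= n.                       *)
Definition ptrace (n t : nat) (rho : 'M[C]_#|bits n|) : 'M[C]_#|bits t| :=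
  \matrix_(x, y) \sum_(c : bits (n - t))
    rho (enum_rank (join_bits (enum_val x) c))
        (enum_rank (join_bits (enum_val y) c)).

Definition reduced_density (n t : nat) (psi : 'cV[C]_n.+1) : 'M[C]_#|bits t| :=
  ptrace t (projector (sym_embedding n *m psi)).

(* The trace is real since the reduced density operator is Hermitian, so no
   information is lost by taking its real part.                                *)
Definition purity (n t : nat) (psi : 'cV[C]_n.+1) : R :=
  complex.Re (\tr (reduced_density t psi *m reduced_density t psi)).

(* Only meaningful for a unit vector psi and 1 <= t <= n.                      *)
Definition anticoherence (n t : nat) (psi : 'cV[C]_n.+1) : R :=
  t.+1%:R / t%:R * (1 - purity t psi).

Definition quantumness (n t : nat) (U : 'M[C]_n.+1) : R :=
  n.+1%:R^-1 * \sum_(i < n.+1) anticoherence t (col i U).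

Definition most_quantum (n : nat) (U : 'M[C]_n.+1) : Prop :=
  U \is unitarymx /\
  forall V : 'M[C]_n.+1, V \is unitarymx -> quantumness 1 V <= quantumness 1 U.

(* unitarymx is phrased with rows; this is about an explicit family of vectors. *)
Definition orthonormal_basis (d : nat) (v : 'I_d -> 'cV[C]_d) : Prop :=
  (forall i j, (v i) ^t* *m v j = (i == j)%:R%:M) /\
  basis_of fullv [tuple v i | i < d].

End Qubits.

Section SpinThreeHalves.
Variable R : realType.
Local Notation C := R[i].

(* e^{i phi} *)
Definition cis (phi : R) : C := cos phi +i* sin phi.

Definition omega3 : C := cis (2 * pi / 3).
Definition theta3 : R := asin (Num.sqrt 3)^-1.
Definition z3 : C := (tan (theta3 / 2))%:C * cis (- (5 * pi / 6)).
Definition xi : C := (1 + z3 + z3^-1) / (Num.sqrt (3 : R))%:C.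

Definition U4q_rows : seq (seq C) :=
  let s3 := (Num.sqrt (3 : R))%:C in
  [:: [:: s3;   1;  1;                1              ];
      [:: 0;    xi; xi * omega3;      xi * omega3 ^+ 2];
      [:: 0;    xi; xi * omega3 ^+ 2; xi * omega3    ];
      [:: - s3; 1;  1;                1              ]].

Definition U4q : 'M[C]_4 :=
  (Num.sqrt (6 : R))%:C^-1 *: \matrix_(k < 4, i < 4) (nth [::] U4q_rows k)`_i.

End SpinThreeHalves.

(* Main.v *)
(* The one-qubit reduced state of a unit vector is a 2 x 2 density matrix, so its
   purity is at least 1/2, with equality when it is the maximally mixed state;
   hence A_1 <= 1 on every vector and B_1 <= 1 on every orthonormal basis. Since
   tan (theta3 / 2) = sqrt 3 - sqrt 2, one gets sqrt 3 * xi = - 2 + i sqrt 2, that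
   is |xi|^2 = 2 and sqrt 3 * (xi + conj xi) = - 4. The first identity makes U4q
   unitary and the second makes every column have reduced state I / 2. *)
Require Import Defs.
From mathcomp Require Import all_boot all_order all_algebra.
From mathcomp Require Import complex.
From mathcomp Require Import reals trigo.
From mathcomp Require Import ring lra.

Set Implicit Arguments.
Unset Strict Implicit.
Unset Printing Implicit Defensive.

Import Order.TTheory GRing.Theory Num.Theory.

Local Open Scope complex_scope.
Local Open Scope ring_scope.
Local Open Scope sesquilinear_scope.

(** * Summation over bit strings *)

Lemma sum_bitsS (V : nmodType) n (G : bits n.+1 -> V) :
  \sum_(b : bits n.+1) G b = \sum_(x : bool) \sum_(b : bits n) G [tuple of x :: b].
Proof.
rewrite pair_big /=.
rewrite (reindex (fun p : bool * bits n => [tuple of p.1 :: p.2])) //=.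
exists (fun b : bits n.+1 => (thead b, [tuple of behead b])) => [[x b] _|b _] /=.
  by congr pair; apply: val_inj.
by rewrite -tuple_eta.
Qed.

(** Induction on the length: the first bit shifts the weight by 0 or 1, and Pascal's rule recombines
    the two halves. This turns traces over qubits into sums over Hamming weights. *)
Lemma sum_bits_count (V : nmodType) n (f : nat -> V) :
  \sum_(b : bits n) f (count_mem true b) = \sum_(0 <= k < n.+1) f k *+ 'C(n, k).
Proof.
elim: n f => [|n IHn] f.
  rewrite big_nat1 bin0 mulr1n (big_pred1 [tuple]) // => b.
  by rewrite [b]tuple0 /= eqxx.
rewrite sum_bitsS big_bool /=.
under eq_bigr do rewrite add1n.
rewrite (IHn (f \o S)) IHn /=.
rewrite [RHS]big_nat_recl // bin0 mulr1n.
under [in RHS]eq_bigr do rewrite binS mulrnDr.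
rewrite big_split /= addrA addrC; congr (_ + _).
rewrite big_nat_recl // bin0 mulr1n; congr (_ + _).
by rewrite [RHS]big_nat_recr //= bin_small // mulr0n addr0.
Qed.

Lemma val_join_bits n t (a : bits t) (c : bits (n - t)) : (t <= n)%N ->
  join_bits a c = a ++ c :> seq bool.
Proof.
move=> tn; apply: (@eq_from_nth _ false) => [|k].
  by rewrite size_cat !size_tuple subnKC.
rewrite size_tuple => ltkn.
by rewrite -[k]/(val (Ordinal ltkn)) -tnth_nth tnth_mktuple.
Qed.

Lemma sum_join_bits (V : nmodType) n t (G : bits n -> V) : (t <= n)%N ->
  \sum_(a : bits t) \sum_(c : bits (n - t)) G (join_bits a c) = \sum_b G b.
Proof.
move=> tn; rewrite pair_big [RHS](reindex (fun p : bits t * bits (n - t) => join_bits p.1 p.2)) //=.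
(* Concatenation is injective between finite sets of equal cardinality, hence bijective. *)
apply: onW_bij; apply: inj_card_bij => [[a c] [a' c']|] /=.
  move/(congr1 val); rewrite /= !val_join_bits //.
  move/eqP; rewrite eqseq_cat ?size_tuple // => /andP[].
  by move=> /eqP/val_inj-> /eqP/val_inj->.
by rewrite card_prod !card_tuple -expnD subnKC.
Qed.

(** * Reduced states of symmetric states and the lower bound on purity *)

Section Purity.
Variable R : realType.
Local Notation C := R[i].

(** The common coordinate of the symmetric state along every ket of Hamming weight [k]. A natural
    index lets the weights of two substrings be added; it is meaningful for [k <= n], because of
    [inord]. *)
Definition dicke_amp n (psi : 'cV[C]_n.+1) (k : nat) : C :=
  (Num.sqrt ('C(n, k)%:R : R))%:C^-1 * psi (inord k) 0.

Lemma dickeE n k (b : bits n) :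
  dicke R n k (enum_rank b) 0 =
  (Num.sqrt ('C(n, k)%:R : R))%:C^-1 * (count_mem true b == k)%:R.
Proof.
rewrite mxE summxE; congr (_ * _).
have [bk|bk] := eqVneq (count_mem true b) k.
  rewrite (bigD1 b) ?bk //= mxE !eqxx big1 ?addr0 // => c /andP[_ /negPf cb].
  by rewrite mxE (inj_eq enum_rank_inj) eq_sym cb.
rewrite big1 // => c ck; rewrite mxE (inj_eq enum_rank_inj).
by have [eqbc|//] := eqVneq b c; rewrite eqbc ck in bk.
Qed.

Lemma sym_embeddingE n (psi : 'cV[C]_n.+1) (b : bits n) :
  (sym_embedding R n *m psi) (enum_rank b) 0 = dicke_amp psi (count_mem true b).
Proof.
rewrite mxE; have ltb : (count_mem true b < n.+1)%N.
  by rewrite ltnS -[X in (_ <= X)%N](size_tuple b) count_size.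
rewrite (bigD1 (inord (count_mem true b))) //= big1 => [|k neqk].
  by rewrite addr0 mxE dickeE inordK // eqxx mulr1.
rewrite mxE dickeE; case: eqP => [eqk|]; last by rewrite mulr0 mul0r.
by rewrite eqk inord_val eqxx in neqk.
Qed.

Lemma projectorE d (v : 'cV[C]_d) x y : projector v x y = v x 0 * (v y 0)^*.
Proof. by rewrite mxE big_ord1 !mxE. Qed.

(** The traced-out string enters only through its weight [k], which is shared by ['C(n - t, k)]
    strings. *)
Lemma reduced_densityE n t (psi : 'cV[C]_n.+1) (a b : bits t) : (t <= n)%N ->
  reduced_density t psi (enum_rank a) (enum_rank b) =
  \sum_(0 <= k < (n - t).+1)
    (dicke_amp psi (count_mem true a + k)
       * (dicke_amp psi (count_mem true b + k))^*) *+ 'C(n - t, k).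
Proof.
move=> tn; rewrite mxE !enum_rankK -(sum_bits_count _ (fun k =>
  dicke_amp psi (count_mem true a + k) * (dicke_amp psi (count_mem true b + k))^*)).
apply: eq_bigr => c _.
by rewrite projectorE !sym_embeddingE !val_join_bits // !count_cat.
Qed.

(** The partial trace preserves the trace and the embedding is isometric: the ['C(n, k)] kets of
    weight [k] cancel the two normalizing square roots. *)
Lemma tr_reduced_density n t (psi : 'cV[C]_n.+1) : (t <= n)%N ->
  \tr (reduced_density t psi) = \sum_k psi k 0 * (psi k 0)^*.
Proof.
move=> tn; rewrite /mxtrace (reindex enum_rank) /=; last first.
  exact/onW_bij/enum_rank_bij.
under eq_bigr do rewrite mxE !enum_rankK.
rewrite (sum_join_bits (fun b => projector _ (enum_rank b) (enum_rank b))) //.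
under [LHS]eq_bigr do rewrite projectorE !sym_embeddingE.
rewrite (sum_bits_count n (fun k => dicke_amp psi k * (dicke_amp psi k)^*)).
rewrite big_mkord; apply: eq_bigr => k _; rewrite /dicke_amp inord_val.
have c0 : 'C(n, k)%:R != 0 :> C by rewrite pnatr_eq0 -lt0n bin_gt0 -ltnS.
set s := Num.sqrt _.
have ss : s%:C * s%:C = 'C(n, k)%:R.
  by rewrite -rmorphM -expr2 sqr_sqrtr ?ler0n // rmorph_nat.
have s0 : s%:C != 0 by apply: contraNneq c0 => s0; rewrite -ss s0 mul0r.
have sJ : (s%:C)^* = s%:C by exact: conjc_real.
by rewrite rmorphM fmorphV /= sJ -mulr_natr -ss; field.
Qed.

Lemma reduced_densityC n t (psi : 'cV[C]_n.+1) x y :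
  reduced_density t psi y x = (reduced_density t psi x y)^*.
Proof.
rewrite !mxE rmorph_sum; apply: eq_bigr => c _.
by rewrite !projectorE rmorphM /= conjCK mulrC.
Qed.

(** For a Hermitian matrix the trace of the square is the squared Frobenius norm. *)
Lemma purityE n t (psi : 'cV[C]_n.+1) :
  (purity t psi)%:C = \sum_x \sum_y `|reduced_density t psi x y| ^+ 2.
Proof.
have eqtr : \tr (reduced_density t psi *m reduced_density t psi)
    = \sum_x \sum_y `|reduced_density t psi x y| ^+ 2.
  apply: eq_bigr => x _; rewrite mxE; apply: eq_bigr => y _.
  by rewrite (reduced_densityC psi x y) normCK.
rewrite /purity eqtr RRe_real // ger0_real //.
by do 2!apply: sumr_ge0 => ? _; rewrite exprn_ge0.
Qed.

(* The variance of the diagonal of a density matrix around the uniform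
   distribution is nonnegative. *)
Lemma purity_ge n t (psi : 'cV[C]_n.+1) : (t <= n)%N ->
  \sum_k psi k 0 * (psi k 0)^* = 1 -> (2 ^+ t)^-1 <= purity t psi.
Proof.
move=> tn norm1; rewrite -lecR purityE fmorphV rmorphXn rmorph_nat.
set rho := reduced_density t psi; set d : C := 2 ^+ t.
have d_real : d^-1 \is Num.real by rewrite realV realX.
have d_neq0 : d != 0 by rewrite expf_neq0 ?pnatr_eq0.
have rho_real x : rho x x \is Num.real.
  by rewrite CrealE -reduced_densityC.
(* Dropping the off-diagonal terms leaves a bound on the diagonal alone. *)
have diag : \sum_x `|rho x x| ^+ 2 <= \sum_x \sum_y `|rho x y| ^+ 2.
  apply: ler_sum => x _; rewrite (bigD1 x) //= lerDl.
  by apply: sumr_ge0 => y _; rewrite exprn_ge0.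
apply: le_trans diag.
have : 0 <= \sum_x (rho x x - d^-1) ^+ 2.
  by apply: sumr_ge0 => x _; rewrite real_exprn_even_ge0 // realB.
have -> : \sum_x (rho x x - d^-1) ^+ 2 = \sum_x `|rho x x| ^+ 2 - d^-1.
  under eq_bigr do rewrite sqrrB -mulrnAr.
  under [in RHS]eq_bigr do rewrite real_normK //.
  rewrite big_split /= sumrB -mulr_suml [\sum_i rho i i]tr_reduced_density // norm1.
  have -> : \sum_(x < #|bits t|) d^-1 ^+ 2 = d^-1.
    rewrite sumr_const card_ord card_tuple card_bool -mulr_natr natrX -/d.
    by field.
  by rewrite mul1r mulr2n opprD addrA addrNK.
by rewrite subr_ge0.
Qed.

Lemma anticoherence1_le n (psi : 'cV[C]_n.+2) :
  \sum_k psi k 0 * (psi k 0)^* = 1 -> anticoherence 1 psi <= 1.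
Proof.
move=> norm1; have := @purity_ge n.+1 1 psi isT norm1.
by rewrite expr1 /anticoherence divr1; lra.
Qed.

Lemma quantumness1_le n (U : 'M[C]_n.+2) :
  U \is unitarymx -> quantumness 1 U <= 1.
Proof.
move=> Uu; rewrite /quantumness ler_pdivrMl ?ltr0n // mulr1.
rewrite -[X in _ <= X%:R]card_ord -sumr_const; apply: ler_sum => i _.
apply: anticoherence1_le; under eq_bigr do rewrite !mxE mulrC.
(* [unitarymx] speaks of rows; passing to the adjoint gives the norms of the columns. *)
move: Uu; rewrite -trmxC_unitary => /unitarymxP/matrixP/(_ i i).
rewrite !mxE eqxx mulr1n => <-; apply: eq_bigr => k _.
by rewrite !mxE conjCK.
Qed.

End Purity.

Lemma orthonormal_basis_unitary (R : realType) d (U : 'M[R[i]]_d) :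
  U \is unitarymx -> orthonormal_basis (fun i => col i U).
Proof.
move=> Uu; split=> [i j|].
  move: Uu; rewrite -trmxC_unitary => /unitarymxP; rewrite -map_trmx trmxK => Uu.
  apply/matrixP => x y; rewrite !ord1 mxE.
  move/matrixP/(_ i j): Uu; rewrite !mxE eqxx mulr1n => <-.
  by apply: eq_bigr => k _; rewrite !mxE conjCK.
rewrite basisEdim size_tuple dimvf dim_matrix mulr1 leqnn andbT.
apply/subvP => v _.
have UV : U *m U^t* = 1%:M by apply/unitarymxP.
(* The columns span, with coordinates read off from [v = U *m (U^t* *m v)]; their number then makes
   them a basis. *)
have -> : v = \sum_i (U^t* *m v) i 0 *: col i U.
  rewrite -[LHS]mul1mx -UV -mulmxA; apply/matrixP => x y; rewrite ord1 mxE summxE.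
  by apply: eq_bigr => k _; rewrite !mxE mulrC.
apply: memv_suml => i _; apply/memvZ/memv_span.
by apply/mapP; exists i; rewrite ?mem_enum.
Qed.

(** * Closed forms and algebraic relations for the constants *)

Section SpinThreeHalves.
Variable R : realType.
Local Notation C := R[i].

Lemma sin_cos_pi6 : sin (pi / 6) = 2^-1 :> R /\ cos (pi / 6) = Num.sqrt 3 / 2 :> R.
Proof.
have pi0 := pi_gt0 R; set p : R := pi / 6.
have c0 : 0 < cos p by apply: cos_gt0_pihalf; rewrite /p; apply/andP; split; lra.
have s0 : 0 < sin p by apply: sin_gt0_pihalf; rewrite /p; apply/andP; split; lra.
have cs := cos2Dsin2 p.
(* The triple-angle formula at [pi / 2] gives [cos p ^+ 2 = 3 * sin p ^+ 2]; positivity then fixes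
   both values. *)
have c3 : cos (p + p + p) = 0.
  by rewrite -(cos_pihalf R); congr cos; rewrite /p; field.
have {}c3 : cos p * (cos p ^+ 2 - 3 * sin p ^+ 2) = 0.
  by rewrite -[RHS]c3 !cosD sinD; ring.
have {}c3 : cos p ^+ 2 = 3 * sin p ^+ 2.
  by apply/eqP; rewrite -subr_eq0; move/eqP: c3; rewrite mulf_eq0 gt_eqF.
have sE : sin p = 2^-1 by nra.
split=> //; apply/eqP; rewrite -(eqrXn2 (n := 2)) ?divr_ge0 ?sqrtr_ge0 // ?ltW //.
rewrite expr_div_n sqr_sqrtr //; apply/eqP.
by rewrite c3 sE; field.
Qed.

Lemma cis_2pi3 : cis (2 * pi / 3) = - 2^-1 +i* (Num.sqrt 3 / 2) :> C.
Proof.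
have [s c] := sin_cos_pi6.
have -> : 2 * pi / 3 = pi / 6 + pi / 2 :> R by field.
by rewrite /cis cosDpihalf sinDpihalf s c.
Qed.

Lemma cis_N5pi6 : cis (- (5 * pi / 6)) = - (Num.sqrt 3 / 2) +i* (- 2^-1) :> C.
Proof.
have [s c] := sin_cos_pi6.
have -> : - (5 * pi / 6) = pi / 6 - pi :> R by field.
by rewrite /cis cosB sinB cospi sinpi s c; congr (_ +i* _); ring.
Qed.

(** This is the half-angle formula tan(θ/2) = (1 - cos θ) / sin θ with sin θ = 1/√3 and cos θ =
    √2/√3. *)
Lemma tan_half_theta3 : tan (theta3 R / 2) = Num.sqrt 3 - Num.sqrt 2.
Proof.
set a : R := theta3 R / 2; set r3 := Num.sqrt 3; set r2 := Num.sqrt 2.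
have r3gt0 : 0 < r3 by rewrite sqrtr_gt0.
have r2gt0 : 0 < r2 by rewrite sqrtr_gt0.
have r3E : r3 ^+ 2 = 3 by rewrite sqr_sqrtr.
have r2E : r2 ^+ 2 = 2 by rewrite sqr_sqrtr.
have r3V_bound : -1 <= r3^-1 <= 1.
  rewrite (le_trans _ (ltW (_ : 0 < _))) ?oppr_le0 ?ler01 ?invr_gt0 //=.
  by rewrite invf_le1 //; nra.
have aa : theta3 R = a + a by rewrite /a; field.
have sin2a : 2 * sin a * cos a = r3^-1.
  by rewrite -[RHS]asinK ?in_itv //= -/(theta3 R) aa sinD; ring.
have cos2a : 1 - 2 * sin a ^+ 2 = r2 / r3.
  have : cos (theta3 R) = r2 / r3.
    rewrite cos_asin // exprVn r3E -[RHS]gtr0_norm ?divr_gt0 // -sqrtr_sqr.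
    by congr Num.sqrt; rewrite expr_div_n r3E r2E; field.
  by rewrite aa cosD => <-; have := cos2Dsin2 a => ?; nra.
have c0 : cos a != 0.
  apply/eqP => c0; move: sin2a; rewrite c0 mulr0 => /esym/eqP.
  by rewrite invr_eq0 gt_eqF.
apply: (mulIf c0); rewrite /tan divfK //.
have r30 : r3 != 0 by rewrite gt_eqF.
have s0 : sin a != 0.
  apply/eqP => s0; move: sin2a; rewrite s0 mulr0 mul0r => /esym/eqP.
  by rewrite invr_eq0 gt_eqF.
have sa : 2 * sin a * cos a * r3 = 1 by rewrite sin2a mulVf.
have ca : 2 * sin a ^+ 2 * r3 = r3 - r2.
  by rewrite -[X in X * _](subKr 1) cos2a; field.
(* After multiplication by [sin a] and [2 * r3], both sides equal [r3 - r2], by [ca] and [sa]. *)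
apply: (mulIf s0).
apply: (mulfI (_ : 2 * r3 != 0)); first by rewrite mulf_neq0 ?pnatr_eq0.
transitivity (r3 - r2); first by rewrite -ca; ring.
transitivity ((r3 - r2) * (2 * sin a * cos a * r3)); first by rewrite sa mulr1.
by ring.
Qed.

Lemma xiE : xi R * (Num.sqrt 3)%:C = - 2 +i* Num.sqrt 2 :> C.
Proof.
have r3gt0 : 0 < Num.sqrt 3 :> R by rewrite sqrtr_gt0.
rewrite /xi divfK; last first.
  by rewrite -(rmorph0 (real_complex R)) (inj_eq (@complexI _)) gt_eqF.
have r3E : Num.sqrt 3 ^+ 2 = 3 :> R by rewrite sqr_sqrtr.
have r2E : Num.sqrt 2 ^+ 2 = 2 :> R by rewrite sqr_sqrtr.
move: (Num.sqrt 3) (Num.sqrt 2) tan_half_theta3 cis_N5pi6 r3E r2E => r3 r2 tE cE r3E r2E.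
have zE : z3 R = (r3 - r2)%:C * (- (r3 / 2) +i* (- 2^-1)) by rewrite /z3 tE cE.
(* The modulus inverts because (√3 - √2)(√3 + √2) = 1, and the phase is conjugated. *)
have -> : (z3 R)^-1 = (r3 + r2)%:C * (- (r3 / 2) +i* 2^-1).
  apply: mulr1_eq; rewrite zE.
  by apply/eqP; rewrite eq_complex /=; apply/andP; split; apply/eqP;
    field: r3E r2E.
rewrite zE; apply/eqP; rewrite eq_complex /=; apply/andP; split; apply/eqP; nra.
Qed.


Lemma omega3_sqr : omega3 R ^+ 2 = - 1 - omega3 R.
Proof.
rewrite /omega3 cis_2pi3; have r3E : Num.sqrt 3 ^+ 2 = 3 :> R by rewrite sqr_sqrtr.
by apply/eqP; rewrite expr2 eq_complex /=; apply/andP; split; apply/eqP; field: r3E.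
Qed.

(** The conjugate is the square of [omega3]; this form keeps expressions of degree at most 1 in
    [omega3]. *)
Lemma omega3_conj : (omega3 R)^* = - 1 - omega3 R.
Proof.
rewrite /omega3 cis_2pi3.
by apply/eqP; rewrite eq_complex /=; apply/andP; split; apply/eqP; field.
Qed.

Lemma conj_realC (x : R) : (x%:C : C)^* = x%:C.
Proof. exact: conjc_real. Qed.

Lemma sqrtC_nat k : (Num.sqrt k%:R : R)%:C ^+ 2 = k%:R :> C.
Proof. by rewrite -rmorphXn /= sqr_sqrtr ?ler0n // rmorph_nat. Qed.

Lemma sqrtC_nat_neq0 k : (Num.sqrt k.+1%:R : R)%:C != 0 :> C.
Proof. by rewrite -sqrf_eq0 sqrtC_nat pnatr_eq0. Qed.

Lemma xi_conjD : (Num.sqrt 3 : R)%:C * (xi R + (xi R)^*) = - 4.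
Proof.
rewrite mulrDr -{2}conj_realC -rmorphM /= mulrC xiE.
by apply/eqP; rewrite eq_complex /=; apply/andP; split; apply/eqP; ring.
Qed.

Lemma xi_conjM : xi R * (xi R)^* = 2.
Proof.
(* The factor 3 is split as √3 times its conjugate, one for each factor, so that [xiE] gives 4 + 2 =
   6. *)
apply: (mulIf (_ : 3 != 0)); first by rewrite pnatr_eq0.
rewrite -(sqrtC_nat 3) expr2 -{2}conj_realC mulrACA -rmorphM xiE.
have r2E : Num.sqrt 2 ^+ 2 = 2 :> R by rewrite sqr_sqrtr.
have -> : (Num.sqrt 3 : R)%:C * (Num.sqrt 3)%:C = 3 by rewrite -expr2 sqrtC_nat.
by apply/eqP; rewrite eq_complex /=; apply/andP; split; apply/eqP; ring: r2E.
Qed.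

Lemma sqrt6_inv_sqr : (Num.sqrt 6 : R)%:C^-1 ^+ 2 = 6^-1 :> C.
Proof. by rewrite exprVn sqrtC_nat. Qed.

End SpinThreeHalves.

(** * Unitarity of [U4q] and the reduced states of its columns *)

Lemma U4q_unitary (R : realType) : U4q R \is unitarymx.
Proof.
apply/unitarymxP/matrixP => k l; rewrite !mxE !big_ord_recl big_ord0 !mxE /U4q_rows.
move: (omega3_sqr R) (omega3_conj R) (xi_conjM R) => w2 wJ xx.
have s3 := sqrtC_nat R 3; have s6 := sqrt6_inv_sqr R.
move: (conj_realC (Num.sqrt 3 : R)) (conj_realC (Num.sqrt 6 : R)) => s3J s6J.
have {}s6 : 6 * (Num.sqrt 6 : R)%:C^-1 ^+ 2 = 1 :> R[i].
  by rewrite s6 divff ?pnatr_eq0.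
(* With the constants abstracted, the sixteen inner products of rows are polynomial identities
   modulo the recorded relations. *)
move: (omega3 R) (xi R) (Num.sqrt 3 : R)%:C (Num.sqrt 6 : R)%:C
  => w x s r in w2 wJ xx s3 s6 s3J s6J *.
case: k => [[|[|[|[|?]]]] ?] //; case: l => [[|[|[|[|?]]]] ?] //; rewrite /=
  !rmorphM fmorphV /= ?(rmorphM, rmorphXn, rmorphN, rmorph0, rmorph1) /=
  ?wJ ?s3J ?s6J.
all: ring: s6 s3 w2 xx.
Qed.

Lemma anticoherence1_half (R : realType) n (psi : 'cV[R[i]]_n.+2) :
  reduced_density 1 psi = (2^-1)%:M -> anticoherence 1 psi = 1.
Proof.
move=> rhoE; rewrite /anticoherence /purity rhoE -scalar_mxM mxtrace_scalar.
rewrite card_tuple card_bool expn1.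
have -> : (2^-1 * 2^-1) *+ 2 = (2^-1 : R)%:C by rewrite fmorphV rmorph_nat; field.
by rewrite /=; field.
Qed.

(** In the last three columns the diagonal is (1 + |ξ|²)/6 = 1/2, and the off-diagonal entries are,
    up to a cube root of unity, multiples of (ξ + conj ξ)/√3 + 2|ξ|²/3 = -4/3 + 4/3. The first
    column has no two adjacent nonzero amplitudes. *)
Lemma reduced_density_U4q (R : realType) i :
  reduced_density 1 (col i (U4q R)) = (2^-1)%:M.
Proof.
have amp k : (k < 4)%N -> dicke_amp (col i (U4q R)) k
    = (Num.sqrt ('C(3, k)%:R : R))%:C^-1
      * ((Num.sqrt (6 : R))%:C^-1 * (nth [::] (U4q_rows R) k)`_i).
  by move=> lt4; rewrite /dicke_amp !mxE inordK.
have sqrt1 : (Num.sqrt (1 : R))%:C^-1 = 1 :> R[i] by rewrite sqrtr1 invr1.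
have binE : ('C(3, 0) = 1%N) * ('C(3, 1) = 3%N) * ('C(3, 2) = 3%N) * ('C(3, 3) = 1%N) by [].
have bin2E : ('C(3 - 1, 0) = 1%N) * ('C(3 - 1, 1) = 2%N) * ('C(3 - 1, 2) = 1%N) by [].
apply/matrixP => x y; rewrite -[x]enum_valK -[y]enum_valK reduced_densityE //.
rewrite mxE (inj_eq enum_rank_inj) -val_eqE.
case/tupleP: (enum_val x) => a u; case/tupleP: (enum_val y) => b v.
rewrite [u]tuple0 [v]tuple0 big_mkord !big_ord_recl big_ord0 {u v} /=.
move: (omega3_sqr R) (omega3_conj R) (xi_conjM R) (xi_conjD R) => w2 wJ xx xD.
have t2 : 3 * (Num.sqrt 3 : R)%:C^-1 ^+ 2 = 1 :> R[i].
  by rewrite exprVn (sqrtC_nat R 3) divff ?pnatr_eq0.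
(* Writing the target 1/2 this way makes 1/6 a common factor, so 1/√6 can stay a free variable. *)
have q2 : 2^-1 = 3 * (Num.sqrt 6 : R)%:C^-1 ^+ 2 :> R[i].
  by rewrite exprVn (sqrtC_nat R 6); field.
have sE : (Num.sqrt 3 : R)%:C = 3 * (Num.sqrt 3)%:C^-1 :> R[i].
  by rewrite -(sqrtC_nat R 3) expr2 mulfK // (sqrtC_nat_neq0 R 2).
have tJ : ((Num.sqrt 3 : R)%:C^-1)^* = (Num.sqrt 3)%:C^-1 :> R[i].
  by rewrite fmorphV /= conj_realC.
have qJ : ((Num.sqrt 6 : R)%:C^-1)^* = (Num.sqrt 6)%:C^-1 :> R[i].
  by rewrite fmorphV /= conj_realC.
(* The sum relation eliminates the conjugate of ξ; the product relation then becomes the quadratic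
   equation [x2]. *)
have xJ : (xi R)^* = - (4 * (Num.sqrt 3 : R)%:C^-1) - xi R.
  transitivity ((Num.sqrt 3 : R)%:C^-1 * ((Num.sqrt 3)%:C * (xi R + (xi R)^*))
                - xi R).
    by rewrite mulKf ?(sqrtC_nat_neq0 R 2) // addrC addKr.
  by rewrite xD; ring.
have x2 : xi R ^+ 2 = - 2 - 4 * (Num.sqrt 3 : R)%:C^-1 * xi R.
  by rewrite -xx xJ; ring.
case: a b => -[]; rewrite /= ?addn0 ?add0n ?add1n ?add2n /= !amp //;
  rewrite !binE !bin2E ?sqrt1 ?mul1r ?mulr1n ?mulr0n ?q2 /U4q_rows /=.
all: move: (xi R) (omega3 R) (Num.sqrt 3 : R)%:C (Num.sqrt 6 : R)%:C^-1
  {xx xD amp} tJ t2 sE q2 qJ w2 wJ xJ x2 => x' w s q.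
(* √3 is replaced by [3 * t], leaving [t] = 1/√3 as the only form of this root. *)
all: move: s^-1 => t tJ t2 -> {s} q2 qJ w2 wJ xJ x2.
all: case: i => [[|[|[|[|?]]]] ?] //=;
  rewrite ?(rmorphM, rmorphXn, rmorphN, rmorph0, rmorph1, rmorph_nat) /=
   ?wJ ?xJ ?tJ ?qJ.
(* [ring] cannot divide coefficients when rewriting with t2. *)
all: have t6 : 6 * t ^+ 2 = 2 by rewrite -[RHS]mulr1 -t2; ring.
all: have t9 : 9 * t ^+ 2 = 3 by rewrite -[RHS]mulr1 -t2; ring.
all: ring: x2 w2 t6 t9.
Qed.

Theorem proposition2 (R : realType) :
  [/\ U4q R \is unitarymx,
      orthonormal_basis (fun i => col i (U4q R)),
      most_quantum (U4q R)
    & quantumness 1 (U4q R) = 1].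
Proof.
have Uu := U4q_unitary R.
have qU : quantumness 1 (U4q R) = 1.
  rewrite /quantumness.
  under eq_bigr do rewrite anticoherence1_half ?reduced_density_U4q //.
  by rewrite sumr_const card_ord mulVf ?pnatr_eq0.
split; [exact: Uu | exact: orthonormal_basis_unitary | split | exact: qU].
  exact: Uu.
by move=> V Vu; rewrite qU; apply: quantumness1_le.
Qed.
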